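(* Let $q$ be a prime power and $m\ge 1$. Let $\Sigma_\infty$ be a hyperplane of ${\rm PG}(4m,q)$, $\mathcal S$ a $(2m-1)$-spread of $\Sigma_\infty$ and $\Pi(\mathcal S)$ the associated translation plane (see context). Fix $\mathbf z\in\mathcal S$, an $(m-1)$-dimensional subspace $\mathcal V\subseteq\mathbf z$, and a $(3m-1)$-dimensional subspace $\Gamma\subseteq\Sigma_\infty$ disjoint from $\mathcal V$. For $\mathbf x\in\mathcal S\setminus\{\mathbf z\}$ let $I(\mathbf x)=\langle\mathbf x,\mathcal V\rangle\cap\Gamma$, and $\mathcal I(\mathcal V)=\{I(\mathbf x):\mathbf x\in\mathcal S\setminus\{\mathbf z\}\}$. Let $\Gamma'$ be a $3m$-dimensional subspace of ${\rm PG}(4m,q)$ with $\Gamma'\cap\Sigma_\infty=\Gamma$, and let $\mathcal F(\mathcal V)$ be the set of $2m$-dimensional subspaces of $\Gamma'$ not contained in $\Gamma$ containing some element of $\mathcal I(\mathcal V)$. Let $\mathcal B$ be a minimal $\mathcal F(\mathcal V)$-blocking set of size $q^{2m}$, and let $\mathcal B^*$ be the point set of $\Pi(\mathcal S)$ consisting of all affine points of the subspaces $\langle\mathcal V,P\rangle$, $P\in\mathcal B$, together with the point $\mathbf z$. Then $\mathcal B^*$ is a unital in $\Pi(\mathcal S)$.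
   Context: A $(t-1)$-spread is a set of $(t-1)$-dimensional subspaces partitioning the points. The André/Bruck–Bose plane $\Pi(\mathcal S)$ has as points the affine points of ${\rm PG}(4m,q)$ (those not in $\Sigma_\infty$) and the elements of $\mathcal S$; as lines the $2m$-dimensional subspaces not contained in $\Sigma_\infty$ meeting $\Sigma_\infty$ in an element of $\mathcal S$, plus the line at infinity $\mathcal S$; incidence is containment. It is a projective plane of order $q^{2m}$. An $\mathcal F(\mathcal V)$-blocking set is a set of points of $\Gamma'\setminus\Gamma$ meeting every element of $\mathcal F(\mathcal V)$; it is minimal if through each of its points $P$ some element of $\mathcal F(\mathcal V)$ meets it exactly in $\{P\}$. A unital in a projective plane of order $n^2$ is a set of $n^3+1$ points such that every line meets it in $1$ or $n+1$ points (here $n=q^m$). *)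

(* Defs.v *)
From HB Require Import structures.
From mathcomp Require Import all_boot all_order all_algebra.

Set Implicit Arguments.
Unset Strict Implicit.
Unset Printing Implicit Defensive.

(* PG(d, q) is the projective space of a vector space W of
   dimension d + 1 over a field F with q elements: its subspaces, points
   included, are the terms of {vspace W}, and those of projective dimension k
   have linear dimension k + 1. *)

(* The subspaces of a finite geometry form a finType, so that sets of points
   and sets of subspaces are {set {vspace W}}. *)
Section FiniteSpace.
Import VectorInternalTheory.
HB.instance Definition _ (F : finFieldType) (W : vectType F) :=
  [Finite of {vspace W} by <:].
End FiniteSpace.

Section IncidenceStructures.

(* The actual points and lines are given by finite sets inside the ambient
   types P and L. *)
Record incidence (P L : finType) := Incidence {
  points : {set P};
  lines : {set L};
  inc : P -> L -> bool
}.

Variables (P L : finType) (G : incidence P L).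

Definition line_points (l : L) : {set P} := [set p in points G | inc G p l].

Definition collinear (A : {set P}) : Prop :=
  exists2 l, l \in lines G & A \subset line_points l.

Definition projective_plane : Prop :=
  [/\ forall p1 p2, p1 \in points G -> p2 \in points G -> p1 != p2 ->
        exists! l, [/\ l \in lines G, inc G p1 l & inc G p2 l],
      forall l1 l2, l1 \in lines G -> l2 \in lines G -> l1 != l2 ->
        exists! p, [/\ p \in points G, inc G p l1 & inc G p l2]
    & exists Q : {set P}, [/\ Q \subset points G, #|Q| = 4
        & forall A : {set P}, A \subset Q -> #|A| = 3 -> ~ collinear A] ].

Definition projective_plane_of_order (k : nat) : Prop :=
  projective_plane /\ forall l, l \in lines G -> #|line_points l| = k.+1.

Definition unital (n : nat) (U : {set P}) : Prop :=
  [/\ projective_plane_of_order (n ^ 2),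
      U \subset points G,
      #|U| = (n ^ 3).+1
    & forall l, l \in lines G ->
        #|U :&: line_points l| = 1 \/ #|U :&: line_points l| = n.+1].

End IncidenceStructures.

Section Geometry.

Variables (F : finFieldType) (W : vectType F).
Implicit Types (U X Sigma Gam V z : {vspace W}).
Implicit Types (S B : {set {vspace W}}).

Definition proj_dim (k : nat) U : bool := \dim U == k.+1.

Definition point U : bool := proj_dim 0 U.

Definition pts U : {set {vspace W}} := [set P | point P & (P <= U)%VS].

Definition affine_pts Sigma U : {set {vspace W}} :=
  [set P in pts U | ~~ (P <= Sigma)%VS].

(* S is a k-spread of Sigma; for a (t-1)-spread take k = t.-1. *)
Definition spread (k : nat) Sigma S : Prop :=
  (forall X, X \in S -> proj_dim k X /\ (X <= Sigma)%VS)
  /\ partition [set pts X | X in S] (pts Sigma).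

Definition bb_points Sigma S : {set {vspace W}} :=
  affine_pts Sigma fullv :|: S.

Definition bb_affine_lines (m : nat) Sigma S : {set {vspace W}} :=
  [set X | [&& proj_dim (2 * m) X, ~~ (X <= Sigma)%VS
             & (X :&: Sigma)%VS \in S]].

(* The line at infinity is encoded as None. *)
Definition bb_inc S (P : {vspace W}) (l : option {vspace W}) : bool :=
  if l is Some X then (P <= X)%VS else P \in S.

Definition bb_plane (m : nat) Sigma S :
    incidence {vspace W} (option {vspace W}) :=
  Incidence (bb_points Sigma S)
            (None |: [set Some X | X in bb_affine_lines m Sigma S])
            (bb_inc S).

Definition Iproj V Gam X : {vspace W} := ((X + V) :&: Gam)%VS.

Definition Iset S z V Gam : {set {vspace W}} :=
  [set Iproj V Gam X | X in S :\ z].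

Definition Fset (m : nat) S z V Gam Gam' : {set {vspace W}} :=
  [set X | [&& proj_dim (2 * m) X, (X <= Gam')%VS, ~~ (X <= Gam)%VS
             & [exists J in Iset S z V Gam, (J <= X)%VS]]].

(* Fam is a family of subspaces of Gam'. *)
Definition blocking_set (Fam : {set {vspace W}}) Gam Gam' B : Prop :=
  B \subset affine_pts Gam Gam'
  /\ forall X, X \in Fam -> exists2 P, P \in B & (P <= X)%VS.

Definition minimal_blocking_set (Fam : {set {vspace W}}) Gam Gam' B : Prop :=
  blocking_set Fam Gam Gam' B
  /\ forall P, P \in B -> exists2 X, X \in Fam & B :&: pts X = [set P].

Definition Bstar Sigma z V B : {set {vspace W}} :=
  z |: \bigcup_(P in B) affine_pts Sigma (V + P)%VS.

End Geometry.

(* Main.v *)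
Require Import Defs.
From mathcomp Require Import all_boot all_order all_algebra.
From mathcomp Require Import all_field.
From mathcomp Require Import zify.

(**
Each affine point Q of B* has a tangent line: if Q lies in <V, P> and the
element Y of F(V), containing I(x), meets B only in P, then <x, Q> projects
from V into Y and meets <V, P> only in Q; the line at infinity is tangent at z.
Since B* has n^3 + 1 points in a plane of order n^2, the equality case of the
Bruen-Thas bound applies: after one tangent per point has been removed, the
remaining lines l satisfy
  sum_l (|l :&: B*| - (n + 1))^2 = 0.
*)

Set Implicit Arguments.
Unset Strict Implicit.
Unset Printing Implicit Defensive.

(** * Counting points, lines and secants in finite projective planes *)

Section Planes.
Variables (P L : finType) (G : incidence P L).

Lemma plane_line_uniq p1 p2 l1 l2 : projective_plane G ->
  p1 \in points G -> p2 \in points G -> p1 != p2 ->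
  l1 \in lines G -> l2 \in lines G ->
  inc G p1 l1 -> inc G p2 l1 -> inc G p1 l2 -> inc G p2 l2 -> l1 = l2.
Proof.
case=> ax _ _ P1 P2 np L1 L2 i11 i21 i12 i22.
by have [l [_ u]] := ax _ _ P1 P2 np; rewrite -(u l1) // -(u l2).
Qed.

Lemma card_lines_through2 p1 p2 : projective_plane G ->
  p1 \in points G -> p2 \in points G -> p1 != p2 ->
  #|[set l in lines G | inc G p1 l && inc G p2 l]| = 1.
Proof.
case=> ax _ _ P1 P2 np; have [l [[Ll i1 i2] u]] := ax _ _ P1 P2 np.
apply/eqP/cards1P; exists l; apply/setP=> l'; rewrite !inE.
apply/idP/eqP => [/and3P[Ll' i1' i2'] | ->]; last by rewrite Ll i1.
by rewrite (u l').
Qed.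

Lemma card_points_on2 l1 l2 : projective_plane G ->
  l1 \in lines G -> l2 \in lines G -> l1 != l2 ->
  #|[set p in points G | inc G p l1 && inc G p l2]| = 1.
Proof.
case=> _ ax _ L1 L2 nl; have [p [[Pp i1 i2] u]] := ax _ _ L1 L2 nl.
apply/eqP/cards1P; exists p; apply/setP=> p'; rewrite !inE.
apply/idP/eqP => [/and3P[Pp' i1' i2'] | ->]; last by rewrite Pp i1.
by rewrite (u p').
Qed.

Lemma double_count (A : {set P}) (D : {set L}) (r : P -> L -> bool) :
  \sum_(p in A) #|[set l in D | r p l]| = \sum_(l in D) #|[set p in A | r p l]|.
Proof.
transitivity (\sum_(p in A) \sum_(l in D) (r p l : nat)).
  apply: eq_bigr => p _; rewrite -sum1dep_card big_mkcondr /=.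
  by apply: eq_bigr => l _; case: r.
rewrite exchange_big; apply: eq_bigr => l _ /=.
rewrite -sum1dep_card [RHS]big_mkcondr /=.
by apply: eq_bigr => p _; case: r.
Qed.

(** If every line passed through [p], the join of any point [b] with a fixed [a] would be the line
    [p a], so the quadrangle [Q] would contain three collinear points. *)
Lemma exists_line_missing p : projective_plane G -> p \in points G ->
  exists2 l, l \in lines G & ~~ inc G p l.
Proof.
move=> PG Pp; have [ax _ [Q [QP Q4 Qcol]]] := PG.
have [/exists_inP //|/exists_inPn h] := boolP [exists l in lines G, ~~ inc G p l].
have [Q0|[a]] := set_0Vmem (Q :\ p).
  by move: (cardsD1 p Q); rewrite Q4 Q0 cards0; case: (p \in Q).
rewrite !inE => /andP[ap aQ]; have Pa := subsetP QP _ aQ.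
have [l [[Ll pl al] _]] := ax _ _ Pp Pa (contra_neq esym ap).
(* Removing this point leaves three points of [Q], all different from [p]. *)
pose x := if p \in Q then p else a.
have xQ : x \in Q by rewrite /x; case: ifP.
case: (Qcol (Q :\ x)); first exact: subD1set.
  by move: (cardsD1 x Q); rewrite Q4 xQ => -[].
exists l => //; apply/subsetP=> b; rewrite !inE => /andP[bx bQ].
have Pb := subsetP QP _ bQ; rewrite Pb /=.
have bp : b != p.
  by apply: contraNneq bx => bp; rewrite /x -bp bQ.
have [-> //|ab] := eqVneq b a.
have [l' [[Ll' bl' al'] _]] := ax _ _ Pb Pa ab.
have pl' : inc G p l' by move: (h _ Ll'); rewrite negbK.
by rewrite (plane_line_uniq PG Pp Pa _ Ll Ll') // eq_sym.
Qed.

Variable k : nat.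
Hypothesis PGk : projective_plane_of_order G k.

(** Joining and intersecting match the lines through [p] with the [k + 1] points of a line missing
    [p]. *)
Lemma card_lines_through p : p \in points G ->
  #|[set l in lines G | inc G p l]| = k.+1.
Proof.
case: PGk => PG lk Pp; have [l0 L0 pl0] := exists_line_missing PG Pp.
have := @double_count (line_points G l0) [set l in lines G | inc G p l] (inc G).
rewrite (eq_bigr (fun=> 1)) => [|x]; last first.
  rewrite inE => /andP[Px xl0].
  rewrite -(card_lines_through2 PG Pp Px); last by apply: contraNneq pl0 => ->.
  by apply: eq_card => l; rewrite !inE andbA.
rewrite [in RHS](eq_bigr (fun=> 1)) => [|l]; last first.
  rewrite inE => /andP[Ll pl].
  rewrite -(card_points_on2 PG L0 Ll); last by apply: contraNneq pl0 => ->.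
  by apply: eq_card => x; rewrite !inE andbA.
by rewrite !sum1_card lk.
Qed.

(** The [k + 1] lines through [p] partition the remaining points into classes of size [k]. *)
Lemma card_plane_points p : p \in points G -> #|points G| = (k * k.+1).+1.
Proof.
move=> Pp; case: (PGk) => PG lk.
have := @double_count (points G :\ p) [set l in lines G | inc G p l] (inc G).
rewrite (eq_bigr (fun=> 1)) => [|x]; last first.
  rewrite inE => /andP[xp Px]; rewrite inE eq_sym in xp.
  rewrite -(card_lines_through2 PG Pp Px) //.
  by apply: eq_card => l; rewrite !inE andbA.
rewrite [in RHS](eq_bigr (fun=> k)) => [|l]; last first.
  rewrite inE => /andP[Ll pl].
  have := lk _ Ll; rewrite (cardsD1 p) inE Pp pl => -[<-].
  by apply: eq_card => x; rewrite !inE andbA.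
rewrite sum1_card sum_nat_const card_lines_through // mulnC => <-.
by rewrite (cardsD1 p) Pp.
Qed.

Lemma card_plane_lines p : p \in points G -> #|lines G| = (k * k.+1).+1.
Proof.
move=> Pp; case: (PGk) => PG lk.
have := @double_count (points G) (lines G) (inc G).
rewrite (eq_bigr (fun=> k.+1)) => [|x Px]; last exact: card_lines_through.
rewrite [in RHS](eq_bigr (fun=> k.+1)) => [|l Ll]; last exact: lk.
by rewrite !sum_nat_const (card_plane_points Pp) => /eqP; rewrite eqn_pmul2r // => /eqP.
Qed.

Lemma sum_card_secants (U : {set P}) : U \subset points G ->
  \sum_(l in lines G) #|U :&: line_points G l| = #|U| * k.+1.
Proof.
move=> UP; rewrite -sum_nat_const.
rewrite -(eq_bigr _ (fun p (Up : p \in U) => card_lines_through (subsetP UP _ Up))).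
rewrite double_count; apply: eq_bigr => l _; apply: eq_card => p; rewrite !inE.
by case Up: (p \in U) => //=; rewrite (subsetP UP).
Qed.

(** The left side counts triples [(x, y, l)] with [x] and [y] in [U] on [l]. A pair with [x = y]
    lies on [k + 1] lines, any other pair on exactly one. *)
Lemma sum_sqr_card_secants (U : {set P}) : U \subset points G ->
  \sum_(l in lines G) #|U :&: line_points G l| ^ 2 = #|U| * (#|U| + k).
Proof.
move=> UP; have [PG lk] := PGk.
transitivity (\sum_(x in U) \sum_(l in lines G | inc G x l) #|U :&: line_points G l|).
  rewrite (exchange_big_dep (mem (lines G))) => [|x l _ /andP[]//] /=.
  apply: eq_bigr => l Ll; rewrite sum_nat_const; congr (_ * _).
  apply: eq_card => x; rewrite !inE [RHS]unfold_in.
  by case Ux: (x \in U) => /=; rewrite ?(subsetP UP) ?Ll.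
rewrite -sum_nat_const; apply: eq_bigr => x Ux; have Px := subsetP UP _ Ux.
transitivity (\sum_(y in U) #|[set l in [set l in lines G | inc G x l] | inc G y l]|).
  rewrite double_count; apply: eq_big => [l|l _]; first by rewrite !inE.
  apply: eq_card => y; rewrite !inE.
  by case Uy: (y \in U) => //=; rewrite (subsetP UP).
rewrite (big_setD1 x) //= (eq_bigr (fun=> 1)) => [|y]; last first.
  rewrite !inE => /andP[yx Uy]; rewrite eq_sym in yx.
  rewrite -(card_lines_through2 PG Px (subsetP UP _ Uy) yx).
  by apply: eq_card => l; rewrite !inE andbA.
have -> : #|[set l in [set l in lines G | inc G x l] | inc G x l]| = k.+1.
  by rewrite -(card_lines_through Px); apply: eq_card => l; rewrite !inE -andbA andbb.
by rewrite sum1_card [#|U| in RHS](cardsD1 x) Ux; lia.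
Qed.
End Planes.

(** Two points other than [p] on each line form the quadrangle: any three of them include two on one
    line and a third off it. The first hypothesis is bare uniqueness of joins, so that the lemma can
    serve while the plane axioms are still being established. *)
Lemma quadrangle_two_lines (P L : finType) (G : incidence P L) p l1 l2 :
  (forall p1 p2 l l', p1 \in points G -> p2 \in points G -> p1 != p2 ->
     l \in lines G -> l' \in lines G ->
     inc G p1 l -> inc G p2 l -> inc G p1 l' -> inc G p2 l' -> l = l') ->
  l1 \in lines G -> l2 \in lines G -> l1 != l2 ->
  p \in line_points G l1 -> p \in line_points G l2 ->
  2 < #|line_points G l1| -> 2 < #|line_points G l2| ->
  exists Q : {set P}, [/\ Q \subset points G, #|Q| = 4
        & forall A : {set P}, A \subset Q -> #|A| = 3 -> ~ collinear G A].
Proof.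
move=> uniq_line L1 L2 n12 p1 p2.
rewrite (cardsD1 p) p1 (cardsD1 p (line_points G l2)) p2 !add1n !ltnS.
move=> /card_gt1P[a [b [+ + ab]]] /card_gt1P[c [d [+ + cd]]].
rewrite !inE in p1 p2 *; case/andP: p1 => Pp p1; case/andP: p2 => _ p2.
move=> /and3P[ap Pa a1] /and3P[bp Pb b1] /and3P[cp Pc c2] /and3P[dp Pd d2].
have off2 x : x \in points G -> x != p -> inc G x l1 -> ~~ inc G x l2.
  move=> Px xp x1; apply: contra n12 => x2.
  by apply/eqP/(uniq_line x p).
have off1 x : x \in points G -> x != p -> inc G x l2 -> ~~ inc G x l1.
  by move=> Px xp x2; apply: contraTN x2; exact: off2.
have neq x y : inc G x l1 -> ~~ inc G y l1 -> x != y.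
  by move=> x1; apply: contraNneq => <-.
have c1 := off1 _ Pc cp c2; have d1 := off1 _ Pd dp d2.
have a2 := off2 _ Pa ap a1; have b2 := off2 _ Pb bp b1.
have [ac ad bc bd] := And4 (neq _ _ a1 c1) (neq _ _ a1 d1) (neq _ _ b1 c1) (neq _ _ b1 d1).
exists [set a; b; c; d]; split.
- by apply/subsetP=> x; rewrite !inE -!orbA => /or4P[] /eqP->.
- rewrite -!setUA !cardsU1 cards1 !inE !negb_or.
  by rewrite ab ac ad bc bd cd.
move=> A AQ A3 [l Ll Al].
have onl x : x \in A -> inc G x l by move/(subsetP Al); rewrite inE => /andP[].
have tri x y w l' : l' \in lines G -> x \in points G -> y \in points G -> x != y ->
    inc G x l' -> inc G y l' -> ~~ inc G w l' -> ~~ [&& x \in A, y \in A & w \in A].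
  move=> Ll' Px Py xy x' y'; apply: contra => /and3P[/onl xl /onl yl /onl].
  by rewrite (uniq_line x y l l').
have := tri a b c l1 L1 Pa Pb ab a1 b1 c1; have := tri a b d l1 L1 Pa Pb ab a1 b1 d1.
have := tri c d a l2 L2 Pc Pd cd c2 d2 a2; have := tri c d b l2 L2 Pc Pd cd c2 d2 b2.
(* Three of the four points would lie in [A], and each of the four possible triples is excluded by
   one instance of [tri]. *)
move: A3; rewrite (cardsD1 a) (cardsD1 b) (cardsD1 c) (cardsD1 d) !inE.
have -> : A :\ a :\ b :\ c :\ d = set0.
  apply/setP=> x; rewrite !inE; apply/negP.
  case/and5P=> /negPf xd /negPf xc /negPf xb /negPf xa /(subsetP AQ).
  by rewrite !inE xa xb xc xd.
rewrite cards0 [b == a]eq_sym [c == a]eq_sym [d == a]eq_sym [c == b]eq_sym.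
rewrite [d == b]eq_sym [d == c]eq_sym ab ac ad bc bd cd /=.
by do 4 case: (_ \in A).
Qed.

Lemma tangents_unital (P L : finType) (G : incidence P L) (n : nat) (U : {set P}) :
  projective_plane_of_order G (n ^ 2) -> U \subset points G ->
  #|U| = (n ^ 3).+1 ->
  (forall p, p \in U -> exists2 l, l \in lines G & U :&: line_points G l = [set p]) ->
  unital G n U.
Proof.
move=> PG UP cU tang; split=> // l Ll.
have [p Up] : exists p, p \in U by apply/set0Pn; rewrite -card_gt0 cU.
have cL := card_plane_lines PG (subsetP UP _ Up).
(* The default [l] only makes [t] total: on [U] the choice of a tangent succeeds. *)
pose t x := odflt l [pick l in lines G | U :&: line_points G l == [set x]].
have tP x : x \in U -> t x \in lines G /\ U :&: line_points G (t x) = [set x].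
  move=> Ux; rewrite /t; case: pickP => [l' /andP[Ll' /eqP]//|/= h].
  by have [l' Ll' e] := tang _ Ux; have := h l'; rewrite Ll' e eqxx.
(* A tangent determines its point of contact, so [T] has exactly [n^3 + 1] lines. *)
have tinj : {in U &, injective t}.
  move=> x y /tP[_ ex] /tP[_ ey] e; apply/set1P.
  by rewrite -ey -e ex set11.
pose T := t @: U; have cT : #|T| = #|U| by rewrite card_in_imset.
have TL : T \subset lines G by apply/subsetP=> _ /imsetP[x /tP[Lx _] ->].
have T1 l' : l' \in T -> #|U :&: line_points G l'| = 1.
  by case/imsetP=> x /tP[_ ex] ->; rewrite ex cards1.
have [/T1|lT] := boolP (l \in T); first by left.
right; pose a l := #|U :&: line_points G l|.
have s1 := sum_card_secants PG UP; have s2 := sum_sqr_card_secants PG UP.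
have cLT : #|lines G :\: T| + #|T| = #|lines G|.
  by rewrite -(cardsID T (lines G)) addnC (setIidPr TL).
rewrite (big_setID T) (setIidPr TL) /= (eq_bigr (fun=> 1)) // sum1_card in s1.
rewrite (big_setID T) (setIidPr TL) /= (eq_bigr (fun=> 1)) in s2; last first.
  by move=> l' /T1 ->.
rewrite sum1_card in s2.
(* Termwise equality in [nat_Cauchy] means [a l' = n + 1], so equality of the two sums forces this
   on every line outside [T]. *)
have le := leqif_sum (fun l' (_ : l' \in lines G :\: T) => nat_Cauchy (a l') n.+1).
(* Outside [T] there are [n^2 (n^2 - n + 1)] lines; their intersection sizes sum to [n^2 (n^3 + 1)]
   and the squares to [n^2 (n + 1) (n^3 + 1)]. Both sides are therefore
   [2 n^2 (n + 1) (n^3 + 1)]. *)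
have : \sum_(l' in lines G :\: T) 2 * (a l' * n.+1) =
       \sum_(l' in lines G :\: T) (a l' ^ 2 + n.+1 ^ 2).
  rewrite [RHS]big_split /= sum_nat_const.
  have -> : \sum_(l' in lines G :\: T) 2 * (a l' * n.+1) =
            2 * ((\sum_(l' in lines G :\: T) a l') * n.+1).
    by rewrite big_distrl big_distrr.
  move: s1 s2 cLT; rewrite cT cU cL -/(a _).
  set A := \sum_(i in _) _; set A2 := \sum_(i in _) _; set N := #|_ :\: _|.
  rewrite !expnS expn0 !muln1; nia.
move/eqP; rewrite le => /forall_inP/(_ l); rewrite inE lT Ll => /(_ isT)/eqP.
exact.
Qed.

(** * Points, vectors and affine parts of subspaces relative to a hyperplane *)

Section Subspaces.
Import GRing.Theory.
Local Open Scope ring_scope.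
Variables (F : finFieldType) (W : vectType F).
Implicit Types (U X Sigma P Q : {vspace W}) (v w a : W).

Lemma pointP P : reflect (exists2 v, v != 0 & P = <[v]>%VS) (point P).
Proof.
apply: (iffP idP) => [|[v v0 ->]]; last by rewrite /point /proj_dim dim_vline v0.
move/eqP=> dP; have v0 : vpick P != 0 by rewrite vpick0 -dimv_eq0 dP.
by exists (vpick P) => //; apply/esym/eqP; rewrite eqEdim dim_vline v0 dP -memvE memv_pick.
Qed.

Lemma pts_vline X v : (<[v]>%VS \in pts X) = (v != 0) && (v \in X).
Proof. by rewrite inE /point /proj_dim dim_vline -memvE; case: (v != 0). Qed.

Lemma pts_inj : injective (@pts F W).
Proof.
suff sub X Y : pts X = pts Y -> (X <= Y)%VS.
  by move=> X Y e; apply/eqP; rewrite eqEsubv !sub.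
move=> e; apply/subvP=> v vX; have [->|v0] := eqVneq v 0; first exact: mem0v.
by have := pts_vline X v; rewrite e pts_vline v0 vX.
Qed.

Lemma affine_ptsP Sigma X P :
  reflect (exists a, [/\ a \in X, a \notin Sigma & P = <[a]>%VS])
          (P \in affine_pts Sigma X).
Proof.
rewrite !inE; apply: (iffP idP) => [/andP[/andP[/pointP[v v0 ->]]]|[a [aX aS ->]]].
  by rewrite -!memvE => vX vS; exists v.
rewrite -!memvE aX aS !andbT; apply/pointP; exists a => //.
by apply: contraNneq aS => ->; exact: mem0v.
Qed.

Lemma affine_notin_hyperplane Sigma X P :
  P \in affine_pts Sigma X -> ~~ (P <= Sigma)%VS.
Proof. by rewrite inE => /andP[]. Qed.

Lemma affine_pts_sub Sigma X P : P \in affine_pts Sigma X -> (P <= X)%VS.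
Proof. by rewrite !inE => /andP[/andP[]]. Qed.

Lemma affine_ptsS Sigma X Y P :
  P \in affine_pts Sigma X -> (P <= Y)%VS -> P \in affine_pts Sigma Y.
Proof. by rewrite !inE => /andP[/andP[-> _] ->] ->. Qed.

(* The vectors of a {vspace W} form a set only over the finType copy finvect_type W of W. *)
Definition vectors X : {set finvect_type W} := [set v : finvect_type W | (v : W) \in X].

Lemma mem_vectors X v : ((v : finvect_type W) \in vectors X) = (v \in X).
Proof. by rewrite inE. Qed.

Lemma card_vectors X : #|vectors X| = (#|F| ^ \dim X)%N.
Proof.
pose f (c : 'rV[F]_(\dim X)) : finvect_type W := \sum_i c 0 i *: (vbasis X)`_i.
have f_inj : injective f.
  move=> c d e; apply/rowP=> i.
  by rewrite -!(coord_sum_free _ _ (basis_free (vbasisP X))) -/(f c) e.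
rewrite -[\dim X]mul1n -card_mx -(card_imset _ f_inj); apply: eq_card => v; rewrite mem_vectors.
apply/idP/imsetP => [vX|[c _ ->]].
  exists (\row_i coord (vbasis X) i v) => //; rewrite /f {1}(coord_vbasis vX).
  by apply: eq_bigr => i _; rewrite mxE.
by apply: rpred_sum => i _; rewrite rpredZ // vbasis_mem // mem_nth ?size_tuple.
Qed.

Variable Sigma : {vspace W}.
Hypothesis hyper : (\dim Sigma).+1 = \dim {: W}.

Lemma dim_cap_hyper U : ~~ (U <= Sigma)%VS -> (\dim (U :&: Sigma)).+1 = \dim U.
Proof.
move=> nU; have := dimv_sum_cap U Sigma.
suff -> : \dim (U + Sigma) = \dim {: W} by rewrite -hyper; lia.
apply/eqP; rewrite eqn_leq dimvS ?subvf // -hyper ltn_neqAle.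
rewrite (dimv_leqif_eq (addvSr U Sigma)) dimvS ?addvSr // andbT.
by apply: contraNneq nU => ->; exact: addvSl.
Qed.

(** A hyperplane and a vector outside it span the space, so [c] is the coordinate of [w] along [a]
    modulo [Sigma]. *)
Lemma hyper_split a w : a \notin Sigma -> exists c, w - c *: a \in Sigma.
Proof.
move=> aS; have : w \in (Sigma + <[a]>)%VS.
  suff /eqP -> : (Sigma + <[a]>)%VS == fullv by exact: memvf.
  rewrite eqEdim subvf -hyper ltn_neqAle dimvS ?addvSl // andbT.
  rewrite (dimv_leqif_eq (addvSl Sigma <[a]>)).
  by apply: contraNneq aS => ->; rewrite memvE addvSr.
by case/memv_addP=> s sS [_ /vlineP[c ->] ->]; exists c; rewrite addrK.
Qed.

(** After scaling, the difference of two affine vectors of [U] lies in [U :&: Sigma], hence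
    vanishes. *)
Lemma affine_pts_eq U P Q : (U :&: Sigma)%VS = 0%VS ->
  P \in affine_pts Sigma U -> Q \in affine_pts Sigma U -> P = Q.
Proof.
move=> U0 /affine_ptsP[a [aU aS ->]] /affine_ptsP[b [bU bS ->]].
have [c bc] := hyper_split b aS; have : b - c *: a \in (U :&: Sigma)%VS.
  by rewrite memv_cap bc rpredB // rpredZ.
rewrite U0 memv0 subr_eq0 => /eqP e; apply/esym/eqP.
have b0 : b != 0 by apply: contraNneq bS => ->; exact: mem0v.
by rewrite eqEdim !dim_vline b0 -memvE e rpredZeq memv_line orbT leq_b1.
Qed.

(* Normalising the coordinate outside Sigma identifies the affine points of X
   with a coset a + (X :&: Sigma). *)
Lemma card_affine_pts X : ~~ (X <= Sigma)%VS ->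
  #|affine_pts Sigma X| = (#|F| ^ (\dim X).-1)%N.
Proof.
move=> nX; rewrite -(dim_cap_hyper nX) /= -card_vectors.
have [a aX aS] := subvPn nX.
pose f (u : finvect_type W) : {vspace W} := <[a + u]>%VS.
have <- : f @: vectors (X :&: Sigma) = affine_pts Sigma X.
  apply/setP=> P; apply/imsetP/affine_ptsP => [[u]|[b [bX bS ->]]].
    rewrite mem_vectors memv_cap => /andP[uX uS] ->; exists (a + u); split=> //.
      exact: rpredD.
    by rewrite rpredDr.
  have [c bc] := hyper_split a bS.
  have c0 : c != 0 by apply: contraNneq aS => c0; move: bc; rewrite c0 scale0r subr0.
  exists (c *: b - a).
    by rewrite mem_vectors memv_cap rpredB ?rpredZ //= -opprB rpredN.
  rewrite /f addrC subrK; apply/eqP; rewrite eqEsubv -!memvE rpredZeq memv_line orbT andbT.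
  by apply/vlineP; exists c^-1; rewrite scalerA mulVf // scale1r.
rewrite card_in_imset // => u v; rewrite !inE !memv_cap => /andP[_ uS] /andP[_ vS].
rewrite /f => e; have /vlineP[c ec] : a + u \in <[a + v]>%VS by rewrite -e memv_line.
(* Since [a] is outside [Sigma], this forces [c = 1], and then [u = v]. *)
have : (1 - c) *: a \in Sigma.
  have -> : (1 - c) *: a = c *: v - u.
    apply/eqP; rewrite scalerBl scale1r subr_eq addrAC eq_sym subr_eq ec.
    by rewrite scalerDr addrC.
  by rewrite rpredB // rpredZ.
rewrite rpredZeq (negPf aS) orbF subr_eq0 => /eqP c1.
by move: ec; rewrite -c1 scale1r => /addrI.
Qed.

(** The modular law reduces this to [P :&: Sigma = 0], which holds because [P] is an affine
    point. *)
Lemma cap_affine_add U X P : (U <= Sigma)%VS -> P \in affine_pts Sigma X ->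
  ((U + P) :&: Sigma)%VS = U.
Proof.
move=> US aP; rewrite -vspace_modl //.
suff /eqP -> : (P :&: Sigma)%VS == 0%VS by rewrite addv0.
have := dim_cap_hyper (affine_notin_hyperplane aP); rewrite -dimv_eq0.
by move: aP; rewrite !inE => /andP[/andP[/eqP -> _] _] [->].
Qed.

Lemma dim_affine_add U X P : (U <= Sigma)%VS -> P \in affine_pts Sigma X ->
  \dim (U + P) = (\dim U).+1.
Proof.
move=> US aP; rewrite -dim_cap_hyper ?(cap_affine_add US aP) //.
by rewrite subv_add US; exact: affine_notin_hyperplane aP.
Qed.

(** The trace of [X] on [Sigma] has codimension one in [X], and [P] lies outside it. *)
Lemma affine_decomp X P : P \in affine_pts Sigma X -> ((X :&: Sigma) + P)%VS = X.
Proof.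
move=> aP; have PX := affine_pts_sub aP; apply/eqP.
rewrite eqEdim subv_add capvSl PX (dim_affine_add (capvSr _ _) aP).
rewrite dim_cap_hyper ?leqnn //; apply: contra (affine_notin_hyperplane aP).
exact: subv_trans.
Qed.

End Subspaces.

(** * Spreads: disjointness, covering and cardinality *)

Section Spreads.
Import GRing.Theory.
Local Open Scope ring_scope.
Variables (F : finFieldType) (W : vectType F) (k : nat).
Variables (Sigma : {vspace W}) (S : {set {vspace W}}).
Hypothesis spS : spread k Sigma S.

Lemma spread_dim X : X \in S -> \dim X = k.+1.
Proof. by case: spS => h _ /h[/eqP]. Qed.

Lemma spread_sub X : X \in S -> (X <= Sigma)%VS.
Proof. by case: spS => h _ /h[]. Qed.

Lemma spread_eq X Y v : X \in S -> Y \in S -> v != 0 -> v \in X -> v \in Y -> X = Y.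
Proof.
case: spS => _ /and3P[_ tI _] XS YS v0 vX vY; apply: pts_inj.
rewrite -(def_pblock tI (imset_f (@pts F W) XS) (_ : <[v]>%VS \in _)) ?pts_vline ?v0 //.
by apply: def_pblock => //; rewrite ?imset_f // pts_vline v0.
Qed.

Lemma spread_cap X Y : X \in S -> Y \in S -> X != Y -> (X :&: Y)%VS = 0%VS.
Proof.
move=> XS YS; apply: contraNeq; rewrite -vpick0 => v0.
have /memv_capP[vX vY] := memv_pick (X :&: Y).
by apply/eqP; exact: spread_eq v0 vX vY.
Qed.

Lemma spread_subv_eq X Y : X \in S -> Y \in S -> (X <= Y)%VS -> X = Y.
Proof. by move=> XS YS XY; apply/eqP; rewrite eqEdim XY !spread_dim ?leqnn. Qed.

Lemma spread_cover v : v \in Sigma -> v != 0 -> exists2 X, X \in S & v \in X.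
Proof.
case: spS => _ /and3P[/eqP cov _ _] vS v0.
have : <[v]>%VS \in pts Sigma by rewrite pts_vline v0.
rewrite -cov => /bigcupP[_ /imsetP[X XS ->]]; rewrite pts_vline => /andP[_ vX].
by exists X.
Qed.

(** The nonzero vectors of the elements of [S] partition the nonzero vectors of [Sigma]. *)
Lemma card_spread :
  (#|S| * (#|F| ^ k.+1).-1)%N = (#|F| ^ \dim Sigma).-1.
Proof.
pose nz (U : {vspace W}) := vectors U :\ 0.
have cnz U : #|nz U| = (#|F| ^ \dim U).-1.
  by rewrite -card_vectors [in RHS](cardsD1 (0 : finvect_type W)) mem_vectors mem0v.
have mem_nz U (v : W) : ((v : finvect_type W) \in nz U) = (v != 0) && (v \in U).
  by rewrite in_setD1 mem_vectors.
have inj : {in S &, injective nz}.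
  move=> X Y XS YS /setP e; apply: spread_subv_eq => //; apply/subvP=> v vX.
  have [->|v0] := eqVneq v 0; first exact: mem0v.
  by have := e v; rewrite !mem_nz v0 vX.
have pa : partition (nz @: S) (nz Sigma).
  apply/and3P; split.
  - apply/eqP/setP=> v; rewrite mem_nz; apply/bigcupP/andP=> [[_ /imsetP[X XS ->]]|[v0 vS]].
      by rewrite mem_nz => /andP[v0 vX]; split=> //; exact: subvP (spread_sub XS) _ vX.
    have [X XS vX] := spread_cover vS v0.
    by exists (nz X); [exact: imset_f | rewrite mem_nz v0].
  - apply/trivIsetP=> _ _ /imsetP[X XS ->] /imsetP[Y YS ->] nXY.
    rewrite -setI_eq0; apply/eqP/setP=> v; rewrite in_setI in_set0 !mem_nz.
    apply/negP=> /andP[/andP[v0 vX] /andP[_ vY]].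
    by case/eqP: nXY; rewrite (spread_eq XS YS v0 vX vY).
  (* No class is empty, since [q^(k+1) - 1] is positive. *)
  - apply/imsetP=> -[X XS e].
    have := cnz X; rewrite -e cards0 spread_dim //.
    have := ltn_expl k.+1 (finNzRing_gt1 F); case: (#|F| ^ k.+1)%N => [|[|]] //.
have := card_partition pa; rewrite cnz => ->.
rewrite big_imset //= (eq_bigr (fun=> (#|F| ^ k.+1).-1)%N) => [|X XS].
  by rewrite sum_nat_const.
by rewrite cnz spread_dim.
Qed.
End Spreads.

(** * The Bruck-Bose incidence structure is a projective plane of order [q^(2m)] *)

Section BruckBose.
Import GRing.Theory.
Local Open Scope ring_scope.
Variables (F : finFieldType) (W : vectType F) (m : nat).
Variables (Sigma : {vspace W}) (S : {set {vspace W}}).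
Hypotheses (m_gt0 : (0 < m)%N) (dimW : \dim {: W} = (4 * m).+1%N).
Hypotheses (dimSigma : \dim Sigma = (4 * m)%N) (spS : spread (2 * m).-1%N Sigma S).
Local Notation G := (bb_plane m Sigma S).
Implicit Types (X L P Q : {vspace W}).

Let hyper : (\dim Sigma).+1 = \dim {: W}. Proof. by rewrite dimSigma dimW. Qed.

Lemma bb_spread_dim X : X \in S -> \dim X = (2 * m)%N.
Proof. by move/(spread_dim spS)->; rewrite prednK // muln_gt0. Qed.

Lemma affine_notin_spread X P : P \in affine_pts Sigma X -> P \notin S.
Proof.
by move/affine_notin_hyperplane; apply: contra; exact: (spread_sub spS).
Qed.

Lemma mem_bb_lines L : (Some L \in lines G) = (L \in bb_affine_lines m Sigma S).
Proof.
rewrite !inE /=; apply/imsetP/idP => [[L' + [->]]|?]; first by rewrite inE.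
by exists L => //; rewrite inE.
Qed.

Lemma bb_linf : None \in lines G. Proof. by rewrite !inE. Qed.

Lemma mem_bb_points P : (P \in points G) = (P \in affine_pts Sigma fullv) || (P \in S).
Proof. by rewrite in_setU. Qed.

Lemma bb_join X Z P : X \in S -> P \in affine_pts Sigma Z -> Some (X + P)%VS \in lines G.
Proof.
move=> XS aP; have XSig := spread_sub spS XS; rewrite mem_bb_lines inE.
rewrite /proj_dim (dim_affine_add hyper XSig aP) bb_spread_dim // eqxx.
rewrite (cap_affine_add hyper XSig aP) XS subv_add negb_and.
by rewrite (affine_notin_hyperplane aP) orbT.
Qed.

Lemma bb_trace L : Some L \in lines G -> (L :&: Sigma)%VS \in S.
Proof. by rewrite mem_bb_lines inE => /and3P[]. Qed.

Lemma bb_line_trace L X : Some L \in lines G -> X \in S -> (X <= L)%VS ->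
  X = (L :&: Sigma)%VS.
Proof.
move=> LG XS XL; apply: (spread_subv_eq spS XS (bb_trace LG)).
by rewrite subv_cap XL (spread_sub spS).
Qed.

Lemma bb_line_decomp L X P : Some L \in lines G -> P \in affine_pts Sigma fullv ->
  (P <= L)%VS -> X \in S -> (X <= L)%VS -> L = (X + P)%VS.
Proof.
move=> LG aP PL XS XL; rewrite -(affine_decomp hyper (affine_ptsS aP PL)).
by rewrite -(bb_line_trace LG XS XL).
Qed.

Lemma bb_two_points P1 P2 : P1 \in points G -> P2 \in points G -> P1 != P2 ->
  exists! l, [/\ l \in lines G, inc G P1 l & inc G P2 l].
Proof.
(* By symmetry, [P1] may be taken affine unless both points are at infinity. *)
wlog : P1 P2 / (P1 \in S) ==> (P2 \in S) => [th|].
  have [/th//|] := boolP ((P1 \in S) ==> (P2 \in S)).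
  rewrite negb_imply => /andP[S1 nS2] G1 G2; rewrite eq_sym => n12.
  have [|l [[Ll i1 i2] u]] := th _ _ _ G2 G1 n12; first by rewrite (negPf nS2).
  by exists l; split=> // l' [Ll' i1' i2']; exact: u.
(* If both points are at infinity, only [None] joins them, because an affine line contains a single
   element of [S], its trace. *)
rewrite !mem_bb_points => imp /orP[a1|S1] + n12; last first.
  rewrite (implyP imp) // => _; exists None; split; first by rewrite bb_linf /= S1 (implyP imp).
  move=> [L|//] [Ll /= i1 i2]; case/eqP: n12.
  have S2 := implyP imp S1.
  by rewrite (bb_line_trace Ll S1 i1) (bb_line_trace Ll S2 i2).
have nS1 := affine_notin_spread a1.
case/orP=> [a2|S2]; last first.
  exists (Some (P2 + P1)%VS); split; first by rewrite (bb_join S2 a1) /= addvSr addvSl.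
  move=> [L|] [Ll i1 i2]; last by rewrite /= (negPf nS1) in i1.
  by rewrite (bb_line_decomp Ll a1 i1 S2 i2).
have /affine_ptsP[a [_ aS e1]] := a1; have /affine_ptsP[b [_ bS e2]] := a2.
(* For two affine points, [b - c *: a] spans the point at infinity of their projective join. The
   element of [S] through it must be the trace of any line of the plane on both. *)
have [c bc] := hyper_split hyper b aS.
have v0 : b - c *: a != 0.
  rewrite subr_eq0; apply: contraNneq n12 => e; apply/eqP.
  apply: (affine_pts_eq hyper (U := P1)); first last.
  - by apply: (affine_ptsS a2); rewrite e1 e2 -memvE e rpredZ // memv_line.
  - exact: affine_ptsS a1 _.
  apply/eqP; rewrite -dimv_eq0 -eqSS dim_cap_hyper ?(affine_notin_hyperplane a1) //.
  by move: a1; rewrite !inE => /andP[/andP[/eqP->]].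
have [X XS vX] := spread_cover spS bc v0.
exists (Some (X + P1)%VS); split.
  rewrite (bb_join XS a1) /= addvSr e2 e1 -memvE -[b](subrK (c *: a)).
  by rewrite memv_add // rpredZ // memv_line.
move=> [L|] [Ll i1 i2]; last by rewrite /= (negPf nS1) in i1.
have vL : b - c *: a \in L.
  by move: i1 i2; rewrite /= e1 e2 -!memvE => aL bL; rewrite rpredB // rpredZ.
have LS := bb_trace Ll.
rewrite (bb_line_decomp Ll a1 i1 LS (capvSl _ _)).
by rewrite (spread_eq spS XS LS v0 vX) // memv_cap vL.
Qed.

Lemma bb_uniq_line P1 P2 l1 l2 : P1 \in points G -> P2 \in points G -> P1 != P2 ->
  l1 \in lines G -> l2 \in lines G -> inc G P1 l1 -> inc G P2 l1 ->
  inc G P1 l2 -> inc G P2 l2 -> l1 = l2.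
Proof.
move=> G1 G2 n12 L1 L2 i11 i21 i12 i22.
by have [l [_ u]] := bb_two_points G1 G2 n12; rewrite -(u l1) // -(u l2).
Qed.

(** Uniqueness follows from [bb_uniq_line]. For existence, affine lines with the same trace meet
    there; otherwise they share a nonzero vector by dimension, and disjointness of spread elements
    makes it affine. *)
Lemma bb_two_lines l1 l2 : l1 \in lines G -> l2 \in lines G -> l1 != l2 ->
  exists! P, [/\ P \in points G, inc G P l1 & inc G P l2].
Proof.
move=> L1 L2 n12.
suff [P [GP i1 i2]] : exists P, [/\ P \in points G, inc G P l1 & inc G P l2].
  exists P; split=> // P' [GP' i1' i2']; apply/eqP; apply: contraNT n12 => nP.
  exact/eqP/(bb_uniq_line GP GP').
have inf L : Some L \in lines G -> exists P, [/\ P \in points G, P \in S & (P <= L)%VS].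
  move=> Ll; exists (L :&: Sigma)%VS; rewrite mem_bb_points bb_trace // orbT.
  by split=> //; exact: capvSl.
case: l1 l2 L1 L2 n12 => [M1|] [M2|] L1 L2 n12 //=; first last.
- exact: inf.
- by have [P []] := inf _ L1; exists P.
have [S1 S2] := (bb_trace L1, bb_trace L2).
have [e|n] := eqVneq (M1 :&: Sigma)%VS (M2 :&: Sigma)%VS.
  exists (M1 :&: Sigma)%VS; rewrite mem_bb_points S1 orbT; split=> //; first exact: capvSl.
  by rewrite e capvSl.
have dimM M : Some M \in lines G -> \dim M = (2 * m).+1%N.
  by rewrite mem_bb_lines inE => /and3P[/eqP].
have v0 : vpick (M1 :&: M2) != 0.
  (* Two subspaces of dimension [2m + 1] cannot be independent in dimension [4m + 1]. *)
  rewrite vpick0 -dimv_eq0 -lt0n.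
  have := dimv_sum_cap M1 M2; have := dimvS (subvf (M1 + M2)).
  rewrite dimW (dimM M1) ?(dimM M2) //; lia.
have /memv_capP[v1 v2] := memv_pick (M1 :&: M2).
exists <[vpick (M1 :&: M2)]>%VS; rewrite -!memvE; split=> //.
rewrite mem_bb_points; apply/orP; left; apply/affine_ptsP.
exists (vpick (M1 :&: M2)); split=> //; first exact: memvf.
apply: contra n => vS; apply/eqP.
by apply: (spread_eq spS S1 S2 v0); rewrite memv_cap vS ?v1 ?v2.
Qed.

(** With [u = q^(2m)], [card_spread] reads [#|S| (u - 1) = u^2 - 1], and [u > 1] permits
    cancellation. *)
Lemma card_bb_spread : #|S| = (#|F| ^ (2 * m)).+1.
Proof.
have := card_spread spS; rewrite dimSigma prednK ?muln_gt0 //.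
have -> : (4 * m = 2 * m + 2 * m)%N by lia.
have := ltn_expl (2 * m) (finNzRing_gt1 F); rewrite expnD.
move: (#|F| ^ (2 * m))%N => u; have : (0 < 2 * m)%N by rewrite muln_gt0.
case: u => [|[|u]] // _; first by lia.
move=> _ /= e; apply/eqP; rewrite -(eqn_pmul2r (_ : 0 < u.+1)%N) // e; lia.
Qed.

(** An affine line consists of its trace and [q^(2m)] affine points; the points of the line at
    infinity are the elements of [S]. *)
Lemma card_bb_line l : l \in lines G -> #|line_points G l| = (#|F| ^ (2 * m)).+1.
Proof.
case: l => [L|] Ll; last first.
  rewrite -card_bb_spread; apply: eq_card => P; rewrite inE mem_bb_points /=.
  by case: (P \in S); rewrite ?andbF ?orbT.
have LS := bb_trace Ll; move: (Ll); rewrite mem_bb_lines inE => /and3P[/eqP dL nL _].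
have -> : line_points G (Some L) = (L :&: Sigma)%VS |: affine_pts Sigma L.
  apply/setP=> P; rewrite inE mem_bb_points in_setU1; apply/andP/orP => [[]|].
    case/orP=> [aP PL|PS PL]; [right|left]; first exact: affine_ptsS aP PL.
    by apply/eqP/(bb_line_trace Ll).
  case=> [/eqP->|aP]; first by rewrite LS orbT /= capvSl.
  by rewrite (affine_ptsS aP (subvf _)) /= (affine_pts_sub aP).
have nLS : (L :&: Sigma)%VS \notin affine_pts Sigma L.
  by apply: contraL LS; exact: affine_notin_spread.
by rewrite cardsU1 nLS (card_affine_pts hyper nL) dL.
Qed.

Lemma bb_plane_order : projective_plane_of_order G (#|F| ^ (2 * m)).
Proof.
split; last exact: card_bb_line.
split; [exact: bb_two_points | exact: bb_two_lines |].
have [X XS] : exists X, X \in S by apply/card_gt0P; rewrite card_bb_spread.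
have [a _ aS] : exists2 a, a \in fullv & a \notin Sigma.
  by apply/subvPn/negP => /dimvS; rewrite -hyper ltnn.
have aP : <[a]>%VS \in affine_pts Sigma fullv.
  by apply/affine_ptsP; exists a; rewrite memvf.
have Ll := bb_join XS aP.
have q2 : (2 < (#|F| ^ (2 * m)).+1)%N.
  by rewrite ltnS (leq_ltn_trans _ (ltn_expl _ (finNzRing_gt1 F))) // muln_gt0.
(* The quadrangle comes from the line at infinity and an affine line, which meet in [X]. *)
apply: (quadrangle_two_lines (p := X) bb_uniq_line bb_linf Ll) => //.
- by rewrite inE mem_bb_points XS orbT.
- by rewrite inE mem_bb_points XS orbT /= addvSl.
- by rewrite card_bb_line ?bb_linf.
- by rewrite card_bb_line.
Qed.

End BruckBose.

(** * Projection from [V] onto [Gam'], and the size and tangents of [B*] *)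

Section MixedProjection.
Import GRing.Theory.
Local Open Scope ring_scope.
Variables (F : finFieldType) (W : vectType F) (m : nat).
Variables (Sigma z V Gam Gam' : {vspace W}) (S B : {set {vspace W}}).
Hypotheses (m_gt0 : (0 < m)%N) (dimW : \dim {: W} = (4 * m).+1%N).
Hypotheses (dimSigma : \dim Sigma = (4 * m)%N) (spS : spread (2 * m).-1%N Sigma S).
Hypotheses (zS : z \in S) (dimV : \dim V = m) (Vz : (V <= z)%VS).
Hypotheses (dimGam : \dim Gam = (3 * m)%N) (GamSigma : (Gam <= Sigma)%VS).
Hypotheses (GamV : (Gam :&: V)%VS = 0%VS) (Gam'Sigma : (Gam' :&: Sigma)%VS = Gam).
Hypothesis hB : minimal_blocking_set (Fset m S z V Gam Gam') Gam Gam' B.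
Local Notation G := (bb_plane m Sigma S).
Local Notation U := (Bstar Sigma z V B).
Implicit Types (X L P Q R : {vspace W}).

Let hyper : (\dim Sigma).+1 = \dim {: W}. Proof. by rewrite dimSigma dimW. Qed.

Let VSigma : (V <= Sigma)%VS.
Proof. exact: subv_trans Vz (spread_sub spS zS). Qed.

Let SigmaE : (Gam + V)%VS = Sigma.
Proof.
apply/eqP; rewrite eqEdim subv_add GamSigma VSigma dimv_disjoint_sum //.
by rewrite dimSigma dimGam dimV; lia.
Qed.

Let Gam'V : (V :&: Gam')%VS = 0%VS.
Proof.
apply/eqP; rewrite -subv0 -GamV -Gam'Sigma !subv_cap capvSl capvSr andbT.
exact: subv_trans (capvSl _ _) VSigma.
Qed.

(** A point of [Gam'] outside [Gam = Gam' :&: Sigma] is outside [Sigma]. *)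
Lemma affine_base P : P \in B -> P \in affine_pts Sigma Gam'.
Proof.
case: hB => -[/subsetP BA _] _ /BA; rewrite !inE => /andP[/andP[-> PG]].
by rewrite PG -Gam'Sigma subv_cap PG.
Qed.

(* Y + V is the preimage of Y under the projection from V onto Gam'. *)
Lemma cap_fibre_base Y : (Y <= Gam')%VS -> ((Y + V) :&: Gam')%VS = Y.
Proof. by move=> YG; rewrite -vspace_modl // Gam'V addv0. Qed.

Lemma fibre_eq P R : P \in B -> R \in affine_pts Sigma (V + P) -> (V + R = V + P)%VS.
Proof.
move=> PB aR; apply/eqP; rewrite eqEdim subv_add addvSl (affine_pts_sub aR) /=.
by rewrite (dim_affine_add hyper VSigma aR) (dim_affine_add hyper VSigma (affine_base PB)).
Qed.

(** Since [V + R = V + P], the point [P] lies in [Y + V], which meets [Gam'] only in [Y]. *)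
Lemma fibre_base P R Y : P \in B -> R \in affine_pts Sigma (V + P) ->
  (Y <= Gam')%VS -> (R <= Y + V)%VS -> (P <= Y)%VS.
Proof.
move=> PB aR YG RY; rewrite -(cap_fibre_base YG) subv_cap (affine_pts_sub (affine_base PB)).
by rewrite andbT (subv_trans (addvSr V P)) // -(fibre_eq PB aR) subv_add addvSr.
Qed.

(** Projecting [R] from [V] recovers its base point: this is [fibre_base] with [P'] as [Y]. *)
Lemma fibre_trivIset P P' R : P \in B -> P' \in B ->
  R \in affine_pts Sigma (V + P) -> R \in affine_pts Sigma (V + P') -> P = P'.
Proof.
move=> PB PB' aR aR'; apply/eqP.
have dim1 Q : Q \in B -> \dim Q = 1%N.
  by move/affine_base; rewrite !inE => /andP[/andP[/eqP]].
rewrite eqEdim !dim1 // andbT (fibre_base PB aR) ?(affine_pts_sub (affine_base PB')) //.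
by rewrite addvC (affine_pts_sub aR').
Qed.

Lemma mem_BstarP Q : reflect (Q = z \/ exists2 P, P \in B & Q \in affine_pts Sigma (V + P))
                             (Q \in U).
Proof.
by rewrite in_setU1; apply: (iffP predU1P) => -[->|h];
   [left | right; exact/bigcupP | left | right; exact/bigcupP].
Qed.

Lemma Bstar_points : U \subset points G.
Proof.
apply/subsetP=> Q /mem_BstarP[->|[P PB aQ]]; rewrite mem_bb_points ?zS ?orbT //.
by rewrite (affine_ptsS aQ (subvf _)).
Qed.

(** Each [V + P] has dimension [m + 1], hence [q^m] affine points; these fibres are disjoint and [z]
    is not affine. *)
Lemma card_Bstar : #|U| = (#|B| * #|F| ^ m).+1.
Proof.
have cfib P : P \in B -> #|affine_pts Sigma (V + P)| = (#|F| ^ m)%N.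
  move=> /affine_base aP.
  rewrite (card_affine_pts hyper) ?(dim_affine_add hyper VSigma aP) ?dimV //.
  by rewrite subv_add negb_and (affine_notin_hyperplane aP) orbT.
have nz : z \notin \bigcup_(P in B) affine_pts Sigma (V + P).
  by apply/bigcupP=> -[P _ /(affine_notin_spread spS)]; rewrite zS.
rewrite cardsU1 nz add1n; congr _.+1.
rewrite -sum_nat_const -(eq_bigr _ cfib) -!sum1_card (eq_bigr _ (fun P _ => esym (sum1_card _))).
(* After the exchange, each [R] is counted once per base point, and [fibre_trivIset] leaves exactly
   one. *)
rewrite (exchange_big_dep (mem (\bigcup_(P in B) affine_pts Sigma (V + P)))) /=; last first.
  by move=> P R PB aR; apply/bigcupP; exists P.
apply: eq_bigr => R /bigcupP[P PB aR]; rewrite (big_pred1 P) // => P'.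
apply/andP/eqP => [[P'B aR']|->]; last by [].
exact: fibre_trivIset aR' aR.
Qed.

Lemma Bstar_tangent Q : Q \in U ->
  exists2 l, l \in lines G & U :&: line_points G l = [set Q].
Proof.
case/mem_BstarP=> [->|[P PB aQ]].
  (* All points of [B*] except [z] are affine, so the line at infinity is tangent at [z]. *)
  exists None; first exact: bb_linf.
  apply/setP=> R; rewrite in_setI in_set1 [R \in line_points _ _]inE.
  apply/andP/eqP => [[+ /andP[_ RS]]|->].
    case/mem_BstarP=> // -[P _ /(affine_notin_spread spS)/negP].
    by case.
  split; first by apply/mem_BstarP; left.
  by rewrite mem_bb_points zS orbT.
have [_ /(_ P PB)[Y YF BY]] := hB.
move: YF; rewrite inE => /and4P[_ YG' _ /exists_inP[_ /imsetP[X + ->] JY]].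
rewrite in_setD1 => /andP[Xz XS].
have XV : (X :&: V)%VS = 0%VS.
  apply/eqP; rewrite -subv0 -(spread_cap spS XS zS Xz).
  exact: capvS (subvv _) Vz.
have XSig := spread_sub spS XS.
(* As [Sigma = Gam + V], the modular law places [X] in [((X + V) :&: Gam) + V], that is [I(X) + V],
   and [Y] contains [I(X)]. *)
have XYV : (X <= Y + V)%VS.
  have : (X <= (X + V) :&: (Gam + V))%VS by rewrite subv_cap addvSl SigmaE.
  by move/subv_trans; apply; rewrite -vspace_modr ?addvSr // addvS.
have PY : (P <= Y)%VS.
  by move: (set11 P); rewrite -BY inE => /andP[_]; rewrite inE => /andP[].
have Ll := bb_join m_gt0 dimW dimSigma spS XS aQ.
exists (Some (X + Q)%VS) => //.
apply/setP=> R; rewrite in_setI in_set1 [R \in line_points _ _]inE.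
apply/andP/eqP => [[+ /andP[_ /= RL]]|->]; last first.
  split; first by apply/mem_BstarP; right; exists P.
  by rewrite mem_bb_points (affine_ptsS aQ (subvf _)) /= addvSr.
case/mem_BstarP=> [Rz|[P' P'B aR]].
  (* The only element of [S] on this line is its trace [X], which differs from [z]. *)
  rewrite Rz in RL; case/eqP: Xz.
  by rewrite (bb_line_trace spS Ll zS RL) (cap_affine_add hyper XSig aQ).
(* The line lies in [Y + V], so the base point of [R] lies in [Y], which meets [B] only in [P]. *)
have PP' : P' = P.
  apply/set1P; rewrite -BY inE P'B /= inE (fibre_base P'B aR YG').
    by move: (affine_base P'B); rewrite !inE => /andP[/andP[-> _] _].
  apply: subv_trans RL _; rewrite subv_add XYV.
  by apply: subv_trans (affine_pts_sub aQ) _; rewrite addvC addvS.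
rewrite PP' in aR.
(* The line and the fibre have traces [X] and [V] on [Sigma]; these are disjoint, so the line and
   the fibre share at most one affine point. *)
apply: (affine_pts_eq hyper (U := ((X + Q) :&: (V + P))%VS)); first last.
- by apply: (affine_ptsS aQ); rewrite subv_cap addvSr (affine_pts_sub aQ).
- by apply: (affine_ptsS aR); rewrite subv_cap RL (affine_pts_sub aR).
apply/eqP; rewrite -subv0 -XV subv_cap.
rewrite -[X in _ && (_ <= X)%VS](cap_affine_add hyper VSigma (affine_base PB)).
rewrite -[X in (_ <= X)%VS && _](cap_affine_add hyper XSig aQ).
by rewrite !capvS ?capvSl ?capvSr.
Qed.

End MixedProjection.

(** * The unital property of [B*] *)

Theorem theorem2 (q m : nat) (F : finFieldType) (W : vectType F)
    (hq : #|F| = q) (hm : 1 <= m)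
    (hW : \dim (fullv : {vspace W}) = (4 * m).+1)
    (Sigma : {vspace W}) (hSigma : proj_dim (4 * m).-1 Sigma)
    (S : {set {vspace W}}) (hS : spread (2 * m).-1 Sigma S)
    (z : {vspace W}) (hz : z \in S)
    (V : {vspace W}) (hVdim : proj_dim m.-1 V) (hVz : (V <= z)%VS)
    (Gam : {vspace W}) (hGamdim : proj_dim (3 * m).-1 Gam)
    (hGamSigma : (Gam <= Sigma)%VS) (hGamV : (Gam :&: V)%VS = 0%VS)
    (Gam' : {vspace W}) (hGam'dim : proj_dim (3 * m) Gam')
    (hGam' : (Gam' :&: Sigma)%VS = Gam)
    (B : {set {vspace W}})
    (hB : minimal_blocking_set (Fset m S z V Gam Gam') Gam Gam' B)
    (hBcard : #|B| = q ^ (2 * m)) :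
  unital (bb_plane m Sigma S) (q ^ m) (Bstar Sigma z V B).
Proof.
(* Projective dimension [k.-1] means linear dimension [k.-1.+1], which equals [k] only for positive
   [k]. *)
have dim_pred k (X : {vspace W}) : 0 < k -> proj_dim k.-1 X -> \dim X = k.
  by move=> k0 /eqP ->; rewrite prednK.
have dS : \dim Sigma = 4 * m by apply: dim_pred; rewrite ?muln_gt0.
have dV : \dim V = m by apply: dim_pred.
have dGam : \dim Gam = 3 * m by apply: dim_pred; rewrite ?muln_gt0.
apply: tangents_unital.
- by rewrite -expnM mulnC -hq; exact: bb_plane_order.
- exact: Bstar_points.
- rewrite (card_Bstar hW dS hS hz dV hVz hGamV hGam' hB) hBcard hq.
  by rewrite -expnD -expnM; congr (_ ^ _).+1; lia.
- exact: (Bstar_tangent hm hW dS hS hz dV hVz dGam hGamSigma hGamV hGam' hB).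
Qed.
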